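(* Fix a prime $p$ and let $G$ be a finitely generated group. Let $H\le G$ be a subnormal subgroup of $p$-power index. Then $RG_p(G)=\frac{RG_p(H)}{[G:H]}$.
   Context: For a group $A$, $d(A)$ is the minimal number of generators and $d_p(A)=d\big(A/[A,A]A^p\big)$. For a finitely generated group $G$, $RG_p(G)=\inf_N\frac{d_p(N)-1}{[G:N]}$, the infimum over normal subgroups $N\trianglelefteq G$ of $p$-power index. *)

(* Defs.v *)
From HB Require Import structures.
From mathcomp Require Import all_boot all_order all_algebra.
From mathcomp Require Import all_classical all_reals.
From mathcomp Require Import monoid.

Set Implicit Arguments.
Unset Strict Implicit.
Unset Printing Implicit Defensive.

Import Order.TTheory GRing.Theory Num.Theory.

Section GroupDefs.
Variable G : groupType.
Implicit Types (K N S : G -> Prop) (x y : G).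

Definition gp_minnat (P : nat -> Prop) : nat :=
  match pselect (exists n, P n) with
  | left h => ex_minn (let: ex_intro n hn := h in
                       ex_intro (fun n => `[< P n >]) n (asboolT hn))
  | right _ => 0%N
  end.

Definition gp_subgroup K : Prop :=
  K 1%g /\ (forall x y, K x -> K y -> K (mul x (inv y))).

Definition gp_gen S x : Prop :=
  forall K, gp_subgroup K -> (forall y, S y -> K y) -> K x.

Definition gp_normal N K : Prop :=
  gp_subgroup N /\ (forall x, N x -> K x) /\
  (forall x k, N x -> K k -> N (conjg x k)).

(* N (a gp_subgroup of K) has gp_index n in K: there is a transversal of
   n elements of K for the left cosets of N in K *)
Definition gp_has_index N K (n : nat) : Prop :=
  exists f : 'I_n -> G, (forall i, K (f i)) /\
    (forall x, K x -> exists! i, N (mul (inv (f i)) x)).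

(* [K : N] (0 when infinite / meaningless) *)
Definition gp_index N K : nat := gp_minnat (gp_has_index N K).

Definition gp_ppower_index (p : nat) N K : Prop :=
  exists k, gp_has_index N K (p ^ k).

Definition gp_Phi_p (p : nat) N : G -> Prop :=
  gp_gen (fun y => (exists a b, N a /\ N b /\ y = commg a b) \/
                (exists a, N a /\ y = natexp a p)).

(* d_p(N) = d(N/[N,N]N^p): the least number of elements of N whose
   images generate N / [N,N]N^p *)
Definition gp_dp (p : nat) N : nat :=
  gp_minnat (fun k => exists f : 'I_k -> G, (forall i, N (f i)) /\
     (forall x, N x -> gp_gen (fun y => (exists i, y = f i) \/ gp_Phi_p p N y) x)).

Definition gp_fin_gen : Prop :=
  exists n (f : 'I_n -> G), forall x, gp_gen (fun y => exists i, y = f i) x.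

Definition gp_subnormal H K : Prop :=
  exists (n : nat) (c : nat -> G -> Prop),
    c 0%N = H /\ c n = K /\ (forall i, (i < n)%N -> gp_normal (c i) (c i.+1)).

Local Open Scope ring_scope.
Definition gp_RGp (R : realType) (p : nat) K : R :=
  inf [set ((gp_dp p N)%:R - 1) / (gp_index N K)%:R | N in
        [set N | gp_normal N K /\ gp_ppower_index p N K]].

End GroupDefs.

(* Main.v *)
(* The basic inequality is Schreier's: if A is normal of index p in B, then
   d_p(A) - 1 <= p (d_p(B) - 1).  If t, t^(e_j) y_j with y_j in A generate B modulo
   [B,B]B^p, then t^p and the conjugates of the y_j by 1, t, ..., t^(p-1) generate A
   modulo [A,A]A^p: if L is the subgroup they span together with [A,A]A^p, then
   W = A/L satisfies W = (t-1)W, while (t-1)^p = t^p - 1 = 0 on W, so W = 0.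
   A subnormal subgroup of p-power index is reached by a chain of normal steps of
   index p.  Hence N |-> (d_p(N) - 1)/[G:N] does not increase when N shrinks along such
   chains; comparing N normal in G with its intersection with H, and N normal in H with
   its core in G, gives the two inequalities between the infima. *)
Require Import Defs.
From HB Require Import structures.
From mathcomp Require Import all_boot all_order all_algebra.
From mathcomp Require Import all_fingroup all_solvable.
From mathcomp Require Import all_classical all_reals.
From mathcomp Require Import monoid.
Import Order.TTheory GRing.Theory Num.Theory.
Local Open Scope ring_scope.
Set Implicit Arguments.
Unset Strict Implicit.
Unset Printing Implicit Defensive.

(** * Subgroups given by predicates, and their abelian quotients *)

Section Subgroups.
Local Open Scope group_scope.
Variable G : groupType.
Implicit Types (A B K L N S : G -> Prop) (x y t : G).

Section Closure.
Variable K : G -> Prop.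
Hypothesis sK : gp_subgroup K.

Lemma gp1 : K 1. Proof. by case: sK. Qed.

Lemma gpV x : K x -> K x^-1.
Proof. by move=> Kx; rewrite -[_^-1]mul1g; apply: sK.2 => //; exact: gp1. Qed.

Lemma gpM x y : K x -> K y -> K (x * y).
Proof. by move=> Kx Ky; rewrite -[y]invgK; apply: sK.2 => //; exact: gpV. Qed.

Lemma gpX n x : K x -> K (x ^+ n).
Proof.
move=> Kx; elim: n => [|n IHn]; first exact: gp1.
by rewrite expgS; exact: gpM.
Qed.

Lemma gpJ x y : K x -> K y -> K (x ^ y).
Proof. by move=> Kx Ky; apply: gpM; [exact: gpV|exact: gpM]. Qed.

Lemma gpR x y : K x -> K y -> K [~ x, y].
Proof. by move=> Kx Ky; apply: gpM; [exact: gpV|exact: gpJ]. Qed.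

Lemma gpMl x y : K x -> K (x * y) <-> K y.
Proof.
move=> Kx; split=> [Kxy|]; last exact: gpM.
by rewrite -[y](mulKg x); apply: gpM => //; exact: gpV.
Qed.

Lemma gpMr x y : K y -> K (x * y) <-> K x.
Proof.
move=> Ky; split=> [Kxy|Kx]; last exact: gpM.
by rewrite -[x](mulgK y); apply: gpM => //; exact: gpV.
Qed.

End Closure.

Lemma gen_subgroup S : gp_subgroup (gp_gen S).
Proof.
split=> [K sK _|x y Sx Sy K sK SK]; first exact: gp1.
by apply: sK.2; [exact: Sx|exact: Sy].
Qed.

Lemma gen_in S x : S x -> gp_gen S x.
Proof. by move=> Sx K _; exact. Qed.

Lemma gen_min S K x : gp_subgroup K -> (forall y, S y -> K y) -> gp_gen S x -> K x.
Proof. by move=> sK SK; apply. Qed.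

Lemma normal_of_comm K B : gp_subgroup K -> (forall x, K x -> B x) ->
  (forall x y, B x -> B y -> K [~ x, y]) -> gp_normal K B.
Proof.
move=> sK KB cK; split=> //; split=> // x k Kx Bk.
by rewrite -[x ^ k](mulVKg x) -commgEl; apply: gpM => //; apply: cK => //; exact: KB.
Qed.

(** The carrier consists of the elements of [B] that are the chosen representatives of their own
    coset of [K]. Commutators lying in [K] make [K] normal, so that products are well defined modulo
    [K], and make the sum commutative. *)
Lemma abelian_quotient B K : gp_subgroup B -> gp_subgroup K ->
  (forall x, K x -> B x) -> (forall x y, B x -> B y -> K [~ x, y]) ->
  exists (V : zmodType) (pi : G -> V),
    (forall x y, B x -> B y -> pi (x * y) = (pi x + pi y)%R) /\
    (forall x, B x -> (pi x = 0%R <-> K x)).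
Proof.
move=> sB sK KB cK.
have [_ [_ nK]] := normal_of_comm sK KB cK.
pose cos x := [set y | K (x^-1 * y)]%classic.
pose r x := xget 1 (cos x).
have rP x : K (x^-1 * r x).
  apply: (@xgetPex _ 1 (cos x)).
  by exists x; rewrite /cos /= mulVg; exact: gp1.
have cosE x y : K (x^-1 * y) -> cos x = cos y.
  move=> Kxy; apply/seteqP; split=> z; rewrite /cos /= => Kz.
    have -> : y^-1 * z = (x^-1 * y)^-1 * (x^-1 * z) by rewrite invgM invgK !gnorm.
    by apply: gpM => //; exact: gpV.
  have -> : x^-1 * z = (x^-1 * y) * (y^-1 * z) by rewrite !gnorm.
  exact: gpM.
have rE x y : K (x^-1 * y) -> r x = r y by rewrite /r => /cosE->.
have rB x : B x -> B (r x).
  by move=> Bx; rewrite -[r x](mulVKg x); apply: gpM => //; apply: KB; exact: rP.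
pose V := {x : G | `[< B x >] && (r x == x)}.
have mkP x : B x -> `[< B (r x) >] && (r (r x) == r x).
  move=> Bx; apply/andP; split; first by apply/asboolP/rB.
  by apply/eqP; exact: esym (rE _ _ (rP x)).
pose mk x (Bx : B x) : V := exist _ (r x) (mkP x Bx).
have VB (u : V) : B (val u) by case: u => x /= /andP[/asboolP].
have mkE x y (Bx : B x) (By : B y) : K (x^-1 * y) -> mk x Bx = mk y By.
  by move=> Kxy; apply/val_inj/rE.
have mkK (u : V) (Bu : B (val u)) : mk (val u) Bu = u.
  by apply/val_inj; case: u Bu => x /= /andP[_ /eqP].
have KC x y : B x -> B y -> K ((x * y)^-1 * (y * x)).
  by move=> Bx By; rewrite invgM -mulgA; exact: (cK y x).
have KM x x' y y' : B x -> B x' -> B y -> B y' -> K (x^-1 * x') -> K (y^-1 * y') ->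
    K ((x * y)^-1 * (x' * y')).
  move=> Bx Bx' By By' Kx Ky.
  have -> : (x * y)^-1 * (x' * y') = (x^-1 * x') ^ y * (y^-1 * y').
    by rewrite conjgE invgM !mulgA mulgK.
  by apply: gpM => //; exact: nK.
pose add (u v : V) : V := mk (val u * val v) (gpM sB (VB u) (VB v)).
pose opp (u : V) : V := mk (val u)^-1 (gpV sB (VB u)).
pose zero : V := mk 1 (gp1 sB).
have mkM x y (Bx : B x) (By : B y) (Bxy : B (x * y)) :
    add (mk x Bx) (mk y By) = mk (x * y) Bxy.
  apply: mkE => /=; rewrite -[_ * _]invgK invgM invgK; apply: gpV => //.
  by apply: KM => //; do ?[exact: rB | exact: rP].
have Krefl x : K (x^-1 * x) by rewrite mulVg; exact: gp1.
have addA : associative add.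
  move=> u v w; rewrite -(mkK u (VB u)) -(mkK v (VB v)) -(mkK w (VB w)).
  have Bu := VB u; have Bv := VB v; have Bw := VB w.
  have Buv := gpM sB Bu Bv; have Bvw := gpM sB Bv Bw.
  rewrite (mkM _ _ _ _ Bvw) (mkM _ _ _ _ Buv).
  rewrite (mkM _ _ _ _ (gpM sB Bu Bvw)) (mkM _ _ _ _ (gpM sB Buv Bw)).
  by apply: mkE; rewrite -(mulgA (val u)); exact: Krefl.
have addC : commutative add by move=> u v; apply: mkE; apply: KC; exact: VB.
have add0 : left_id zero add.
  move=> u; rewrite -(mkK u (VB u)) (mkM _ _ _ _ (gpM sB (gp1 sB) (VB u))).
  by apply: mkE; rewrite mul1g; exact: Krefl.
have addN : left_inverse zero opp add.
  move=> u; rewrite -{2}(mkK u (VB u)) (mkM _ _ _ _ (gpM sB (gpV sB (VB u)) (VB u))).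
  by apply: mkE; rewrite mulVg; exact: Krefl.
pose W : zmodType := HB.pack_for zmodType V
  (@GRing.isZmodule.Build V zero opp add addA addC add0 addN).
pose pi x : W := if pselect (B x) is left h then mk x h else zero.
have piE x (Bx : B x) : pi x = mk x Bx.
  by rewrite /pi; case: pselect => // Bx'; exact: mkE.
exists W, pi; split=> [x y Bx By|x Bx].
  by rewrite (piE _ Bx) (piE _ By) (piE _ (gpM sB Bx By)); rewrite -mkM.
rewrite (piE _ Bx); split=> [/(congr1 val) /= rx1|Kx].
  suff : K (r x) by move=> /(gpM sK)/(_ (gpV sK (rP x))); rewrite invgM invgK mulVKg.
  by rewrite [r x]rx1; have := rP 1; rewrite invg1 mul1g.
by apply: mkE; rewrite mulg1; exact: gpV.
Qed.

End Subgroups.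

(** A formal binomial theorem: think of [a n i] as $(1+D)^n D^i v$. It serves for $D = t-1$, with
    $t$ acting by conjugation. *)
Lemma pascal_sum (V : zmodType) (a : nat -> nat -> V) :
  (forall n i, a n.+1 i = a n i + a n i.+1) ->
  forall n i, a n i = \sum_(j < n.+1) a 0 (i + j)%N *+ 'C(n, j).
Proof.
move=> aS; elim=> [|n IHn] i.
  by rewrite big_ord_recl big_ord0 addn0 bin0 addr0.
rewrite aS !IHn [RHS]big_ord_recl bin0 addn0.
under [X in _ = _ + X]eq_bigr => j _ do
  rewrite lift0 binS mulrnDr -addSnnS.
rewrite big_split /= addrA; congr (_ + _).
rewrite [in RHS]big_ord_recr /= bin_small // mulr0n addr0.
rewrite big_ord_recl bin0 addn0; congr (_ + _).
by apply: eq_bigr => j _; rewrite lift0 addSnnS.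
Qed.

(** * Normal steps of index $p$ and Schreier's inequality *)

Section Step.
Local Open Scope group_scope.
Variable G : groupType.
Implicit Types (A B K L N S : G -> Prop) (x y t : G).

Lemma conjg_mulR x y : x ^ y = x * [~ x, y].
Proof. by rewrite commgEl mulVKg. Qed.

(** For prime [p] this says that [A] is normal of index [p] in [B]. Stated through powers of an
    arbitrary outside element instead of a transversal, it passes easily to intersections and
    conjugates. *)
Definition pstep p A B : Prop :=
  [/\ gp_subgroup B, gp_normal A B, (exists t, B t /\ ~ A t) &
      forall t, B t -> ~ A t ->
        A (t ^+ p) /\ forall x, B x -> exists i, A (t ^- i * x)].

(** [gp_dp p N] is the least such [d]. Since [gp_minnat] gives 0 when there is none, existence has
    to be carried along separately. *)
Definition dpgen p N d : Prop :=
  exists f : 'I_d -> G, (forall i, N (f i)) /\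
    (forall x, N x -> gp_gen (fun y => (exists i, y = f i) \/ gp_Phi_p p N y) x).

Lemma dpgen_finType p N (I : finType) (f : I -> G) : (forall i, N (f i)) ->
  (forall x, N x -> gp_gen (fun y => (exists i, y = f i) \/ gp_Phi_p p N y) x) ->
  dpgen p N #|I|.
Proof.
move=> Nf genf; exists (f \o enum_val); split=> [i|x /genf]; first exact: Nf.
apply: gen_min; first exact: gen_subgroup.
move=> y [[i ->]|Phiy]; apply: gen_in; last by right.
by left; exists (enum_rank i); rewrite /= enum_rankK.
Qed.

(** Otherwise Bezout gives $up = vn+1$, and $t = t^{-vn}t^{up}$ lies in [A]. *)
Lemma prime_expg_mem p A t n : gp_subgroup A -> prime p -> ~ A t ->
  A (t ^+ p) -> A (t ^+ n) -> (p %| n)%N.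
Proof.
move=> sA pr_p At Atp Atn; rewrite -[(p %| n)%N]negbK -prime_coprime //.
apply/negP => /(coprimeP _ (prime_gt0 pr_p)) [[u v] /= uv1].
apply: At; have uv : (u * p)%N = (v * n + 1)%N.
  by rewrite -uv1 subnKC // ltnW // -subn_gt0 uv1.
rewrite -[t](mulKg (t ^+ (v * n))) -expgSr -addn1 -uv.
have AX m k : A (t ^+ m) -> A (t ^+ (k * m)).
  by move=> Atm; rewrite mulnC expgnA; exact: gpX.
by apply: gpM; [|apply: gpV|]; rewrite ?AX //; apply: AX.
Qed.

Lemma centralizer_mod_subgroup K B y : gp_subgroup B -> gp_normal K B -> B y ->
  gp_subgroup (fun x => B x /\ K [~ x, y]).
Proof.
move=> sB [sK [KB nK]] By; split=> [|x z [Bx Kx] [Bz Kz]].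
  by split; rewrite ?comm1g; exact: gp1.
have BzV := gpV sB Bz; split; first exact: gpM.
have -> : [~ x / z, y] = [~ x, y] ^ z^-1 * ([~ z, y]^-1) ^ z^-1.
  by rewrite /commg /conjg !gnorm.
by apply: gpM => //; apply: nK => //; exact: gpV.
Qed.

(** * Extensions of [A] by the powers of one element [t] *)

Section Cyclic.
Variables (p : nat) (A B : G -> Prop) (t : G).
Hypotheses (sB : gp_subgroup B) (nAB : gp_normal A B) (Bt : B t).
Hypothesis BtA : forall x, B x -> exists i, A (t ^- i * x).

Let sA : gp_subgroup A. Proof. by case: nAB. Qed.
Let AB x : A x -> B x. Proof. by case: nAB => _ [AB _]; exact: AB. Qed.

Lemma cyclic_ext_sub C : gp_subgroup C -> (forall a, A a -> C a) -> C t ->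
  forall x, B x -> C x.
Proof.
move=> sC AC Ct x /BtA[i /AC Cx].
by rewrite -[x](mulVKg (t ^+ i)); apply: gpM => //; exact: gpX.
Qed.

(** Exponents in [BtA] are natural numbers, so besides [A] only conjugation by [t], not by its
    inverse, has to be tested. *)
Lemma cyclic_ext_normal K : gp_subgroup K -> (forall x, K x -> A x) ->
  (forall x a, K x -> A a -> K (x ^ a)) -> (forall x, K x -> K (x ^ t)) ->
  gp_normal K B.
Proof.
move=> sK KA KAJ Kt; split=> //; split=> [x /KA /AB //|x b Kx /BtA[i Ab]].
rewrite -[b](mulVKg (t ^+ i)) conjgM; apply: KAJ => //.
elim: i {Ab} => [|i IHi]; first by rewrite conjg1.
by rewrite expgSr conjgM; exact: Kt.
Qed.

(** [A] and [t] generate [B] and commute modulo [K]. Centralizers modulo [K] extend this to all of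
    [B]: first that of an element of [A], then that of [t], then that of any element. *)
Lemma cyclic_ext_comm K : gp_normal K B -> (forall a, A a -> K [~ a, t]) ->
  (forall a b, A a -> A b -> K [~ a, b]) ->
  forall x y, B x -> B y -> K [~ x, y].
Proof.
move=> nKB Kt KA; have sK : gp_subgroup K by case: nKB.
have Ktl x : K [~ x, t] -> K [~ t, x] by move=> /(gpV sK); rewrite invgR.
have KBy y : B y -> (forall a, A a -> K [~ a, y]) -> K [~ t, y] ->
    forall x, B x -> K [~ x, y].
  move=> By KAy Kty x Bx.
  have sC := centralizer_mod_subgroup sB nKB By.
  by have [] := cyclic_ext_sub sC (fun a Aa => conj (AB Aa) (KAy a Aa)) (conj Bt Kty) Bx.
have KBA x a : B x -> A a -> K [~ x, a].
  by move=> Bx Aa; apply: KBy => //; [exact: AB|move=> b Ab; exact: KA|exact/Ktl/Kt].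
have KBt x : B x -> K [~ x, t].
  by move=> Bx; apply: KBy => //; rewrite commgg; exact: gp1.
move=> x y Bx By; apply: KBy => //; last exact/Ktl/KBt.
by move=> a Aa; rewrite -invgR; apply: gpV => //; exact: KBA.
Qed.

Lemma quotient_morphX (V : zmodType) (pi : G -> V) N x n : gp_subgroup N ->
  (forall x y, N x -> N y -> pi (x * y) = (pi x + pi y)%R) -> N x ->
  pi (x ^+ n) = (pi x *+ n)%R.
Proof.
move=> sN piM Nx; elim: n => [|n IHn].
  have := piM 1 1 (gp1 sN) (gp1 sN); rewrite mulg1 -{1}[pi 1]addr0.
  by move/addrI=> <-; rewrite mulr0n.
by rewrite expgS piM ?IHn ?mulrS //; exact: gpX.
Qed.

(** $B/K$ is abelian and generated by elements killed by $p$. *)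
Lemma cyclic_ext_Phi K : gp_normal K B -> (forall a, A a -> K [~ a, t]) ->
  (forall a b, A a -> A b -> K [~ a, b]) -> (forall a, A a -> K (a ^+ p)) ->
  K (t ^+ p) -> forall x, gp_Phi_p p B x -> K x.
Proof.
move=> nKB Kt KA KAp Ktp; have [sK [KB _]] := nKB.
have KBB := cyclic_ext_comm nKB Kt KA.
have [V [pi [piM piK]]] := abelian_quotient sB sK KB KBB.
have piX := quotient_morphX _ sB piM.
move=> x; apply: gen_min => // y [[a [b [Ba [Bb ->]]]]|[b [Bb ->]]]; first exact: KBB.
apply/piK; first exact: gpX.
have [i Aa] := BtA Bb; rewrite -[b](mulVKg (t ^+ i)).
have Ba := AB Aa; have Bti := gpX sB i Bt.
rewrite piX; last exact: gpM.
rewrite (piM _ _ Bti Ba) (piX t) //.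
have tp0 : (pi t *+ p = 0)%R by rewrite -piX //; apply/piK => //; exact: gpX.
have ap0 : (pi (t ^- i * b)%g *+ p = 0)%R.
  by rewrite -piX //; apply/piK; [exact: gpX|exact: KAp].
by rewrite mulrnDl mulrnAC tp0 ap0 mul0rn addr0.
Qed.

Lemma Phi_conj N x y : (forall z, N z -> N (z ^ y)) ->
  gp_Phi_p p N x -> gp_Phi_p p N (x ^ y).
Proof.
move=> Ny; apply: (gen_min (K := fun x => gp_Phi_p p N (x ^ y))).
  have sPhi := gen_subgroup (fun y => (exists a b, N a /\ N b /\ y = commg a b) \/
                (exists a, N a /\ y = natexp a p)).
  split=> [|u v Phiu Phiv]; first by rewrite conj1g; exact: gp1.
  by rewrite conjMg conjVg; exact: sPhi.2.
move=> _ [[a [b [Na [Nb ->]]]]|[b [Nb ->]]]; apply: gen_in.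
  by left; exists (a ^ y), (b ^ y); rewrite conjRg; split; [|split] => //; exact: Ny.
by right; exists (b ^ y); rewrite conjXg; split=> //; exact: Ny.
Qed.

Hypotheses (pr_p : prime p) (At : ~ A t) (Atp : A (t ^+ p)).

(* On the elementary abelian group A / [A,A]A^p conjugation by t has order p, so
   (t - 1)^p = t^p - 1 = 0. *)
Lemma iter_commg_mem L a : gp_subgroup L -> (forall x, L x -> A x) ->
  (forall x y, A x -> A y -> L [~ x, y]) -> (forall x, A x -> L (x ^+ p)) ->
  A a -> L (iter p (commg^~ t) a).
Proof.
move=> sL LA LAA LAp Aa.
have [V [pi [piM piK]]] := abelian_quotient sA sL LA LAA.
have piX := quotient_morphX _ sA piM.
have [_ [_ nA]] := nAB.
have AD n : A (iter n (commg^~ t) a).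
  elim: n => //= n IHn; rewrite commgEl.
  by apply: gpM => //; [exact: gpV|exact: nA].
(* [c n i] is $t^n (t-1)^i$ applied to the class of [a], so [cS] is Pascal's rule. *)
pose c n i := pi (iter i (commg^~ t) a ^ (t ^+ n)).
have AJ x n : A x -> A (x ^ (t ^+ n)) by move=> Ax; apply: nA => //; exact: gpX.
have cS n i : c n.+1 i = (c n i + c n i.+1)%R.
  by rewrite /c expgS conjgM [_ ^ t]conjg_mulR conjMg piM //;
    [exact: AJ (AD i)|exact: AJ (AD i.+1)].
have c0 i : c 0 i = pi (iter i (commg^~ t) a) by rewrite /c conjg1.
have cp : c p 0 = c 0 0.
  rewrite c0 /c /= conjg_mulR piM //; last exact: gpR.
  have /(piK _ (gpR sA Aa Atp)) -> := LAA _ _ Aa Atp.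
  by rewrite addr0.
have cp0 i : (c 0 i *+ p = 0)%R.
  by rewrite c0 -piX //; apply/piK; [exact: gpX|exact: LAp].
(* In the expansion of $(1+(t-1))^p a$ the term of degree 0 cancels against $t^p a = a$, and the
   middle binomial coefficients are divisible by $p$; only $(t-1)^p a$ is left. *)
have := pascal_sum cS p 0; rewrite cp -(prednK (prime_gt0 pr_p)).
rewrite big_ord_recl big_ord_recr /= addn0 bin0 mulr1n -{1}[c 0 0]addr0.
move/addrI; rewrite big1 ?add0r => [|j _].
  rewrite /bump leq0n add1n binn mulr1n prednK ?prime_gt0 // add0n c0.
  rewrite -[X in _ -> L X]/(iter p.-1.+1 (commg^~ t) a) prednK ?prime_gt0 //.
  by move/esym/(piK _ (AD p)).1.
rewrite /bump leq0n add1n prednK ?prime_gt0 //=.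
have /dvdnP[m ->] : (p %| 'C(p, j.+1))%N.
  apply: prime_dvd_bin => //=.
  by rewrite -[X in (_ < X)%N](prednK (prime_gt0 pr_p)) ltnS ltn_ord.
by rewrite mulnC mulrnA cp0 mul0rn.
Qed.

(** Let [L] be the subgroup so generated and [K] the preimage in [A] of $(t-1)(A/L)$. Modulo [K],
    the group [B] is generated by [t] alone, which forces [K] to be all of [A]; so $t-1$ is onto on
    $A/L$, while its $p$-th power is 0. The index [None] stands for $t^p$, and [Some (j, r)] for the
    conjugate of [y j] by $t^r$. *)
Lemma cyclic_ext_gen d (y : 'I_d -> G) (e : 'I_d -> nat) :
  (forall j, A (y j)) ->
  (forall x, B x -> gp_gen (fun z => z = t \/
     (exists j, z = t ^+ e j * y j) \/ gp_Phi_p p B z) x) ->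
  forall x, A x -> gp_gen (fun z =>
    (exists o : option ('I_d * 'I_p),
      z = oapp (fun jr : 'I_d * 'I_p => y jr.1 ^ (t ^+ jr.2)) (t ^+ p) o) \/ gp_Phi_p p A z) x.
Proof.
move=> Ay genB; set S := (X in gp_gen X).
have [_ [_ nA]] := nAB.
pose L := gp_gen S; have sL : gp_subgroup L by exact: gen_subgroup.
have LS z : S z -> L z by exact: gen_in.
have AJ x n : A x -> A (x ^ (t ^+ n)) by move=> Ax; apply: nA => //; exact: gpX.
have LAA a b : A a -> A b -> L [~ a, b].
  by move=> Aa Ab; apply: (LS); right; apply: gen_in; left; exists a, b.
have LAp a : A a -> L (a ^+ p).
  by move=> Aa; apply: (LS); right; apply: gen_in; right; exists a.
have LA x : L x -> A x.
  apply: gen_min => // z [[[[j r]|] ->]|] //=; first exact: AJ.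
  by apply: gen_min => // _ [[a [b [Aa [Ab ->]]]]|[a [Aa ->]]]; [exact: gpR|exact: gpX].
have LJA x a : L x -> A a -> L (x ^ a).
  have [_ [_ nL]] := normal_of_comm sL LA LAA; exact: nL.
have Ltp : L (t ^+ p) by apply: (LS); left; exists None.
have Ly j : L (y j).
  by apply: (LS); left; exists (Some (j, Ordinal (prime_gt0 pr_p))); rewrite /= conjg1.
have Lt x : L x -> L (x ^ t).
  apply: (gen_min (K := fun x => L (x ^ t))).
    split=> [|u v Lu Lv]; first by rewrite conj1g; exact: gp1.
    by rewrite conjMg conjVg; exact: sL.2.
  move=> z [[[[j r]|] ->]|Phiz] /=; last 2 first.
  - by rewrite conjXg conjgE mulKg.
  - by apply: (LS); right; apply: Phi_conj => // u Au; exact: nA.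
  (* Conjugation by [t] shifts the list of conjugates; at the end $r+1=p$ the conjugating element
     $t^p$ lies in [A], under which [L] is stable. *)
  rewrite -conjgM -expgSr; have [rp|] := ltnP r.+1 p.
    by apply: (LS); left; exists (Some (j, Ordinal rp)).
  move=> pr; have -> : r.+1 = p by apply/eqP; rewrite eqn_leq pr andbT.
  exact: LJA.
pose K x := A x /\ exists2 a, A a & L ([~ a, t]^-1 * x).
have [V [pi [piM piK]]] := abelian_quotient sA sL LA LAA.
have piV x : A x -> pi x^-1 = (- pi x)%R.
  move=> Ax; apply/eqP; rewrite -addr_eq0 -piM //; last exact: gpV.
  by rewrite mulVg; apply/eqP/piK; exact: gp1.
have piE x z : A x -> A z -> (L (x^-1 * z) <-> pi z = pi x).
  move=> Ax Az; rewrite -piK; last by apply: gpM => //; exact: gpV.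
  rewrite piM ?piV //; last exact: gpV.
  by rewrite addrC; split=> [/eqP|->]; [rewrite subr_eq0 => /eqP|rewrite subrr].
have AD a : A a -> A [~ a, t].
  by move=> Aa; rewrite commgEl; apply: gpM => //; [exact: gpV|exact: nA].
have At1 a : A a -> A (a ^ t) by move=> Aa; exact: nA.
have piD a : A a -> pi [~ a, t] = (pi (a ^ t)%g - pi a)%R.
  by move=> Aa; rewrite commgEl piM ?piV 1?addrC //; [exact: gpV|exact: At1].
have KE x : K x <-> A x /\ exists2 a, A a & pi x = pi [~ a, t].
  split=> -[Ax [a Aa]] Lax; split=> //; exists a => //.
    by apply/piE => //; exact: AD.
  by apply/piE => //; exact: AD.
have sK : gp_subgroup K.
  split=> [|u v /KE[Au [a Aa au]] /KE[Av [b Ab bv]]]; apply/KE.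
    split; first exact: gp1.
    by exists 1; [exact: gp1|rewrite comm1g].
  split; first exact: sA.2.
  exists (a / b); first exact: sA.2.
  have AbV := gpV sA Ab; have AbtV := gpV sA (At1 _ Ab).
  rewrite piM ?piV //; last exact: gpV.
  rewrite piD; last exact: gpM.
  rewrite conjMg conjVg (piM _ _ (At1 _ Aa) AbtV) (piM _ _ Aa AbV) !piV //; last exact: At1.
  by rewrite au bv !piD // !opprD !opprK addrACA.
have KA x : K x -> A x by case.
have LK x : L x -> K x.
  move=> Lx; split; first exact: LA.
  by exists 1; [exact: gp1|rewrite comm1g invg1 mul1g].
have KAA a b : A a -> A b -> K [~ a, b] by move=> Aa Ab; exact: LK (LAA _ _ Aa Ab).
have nKB : gp_normal K B.
  apply: cyclic_ext_normal => // [x a|x [Ax [a Aa Lax]]].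
    have [_ [_ nK]] := normal_of_comm sK KA KAA; exact: nK.
  split; first exact: At1.
  exists (a ^ t); first exact: At1.
  have tt : t ^ t = t by rewrite conjgE mulKg.
  by rewrite -[X in [~ _, X]]tt -conjRg -conjVg -conjMg; exact: Lt.
have KD a : A a -> K [~ a, t].
  by move=> Aa; split; [exact: AD|exists a => //; rewrite mulVg; exact: gp1].
have PhiK := cyclic_ext_Phi nKB KD KAA (fun a Aa => LK _ (LAp a Aa)) (LK _ Ltp).
have [_ [KB nK]] := nKB.
have sC : gp_subgroup (fun x => B x /\ exists i, K (t ^- i * x)).
  split=> [|u v [Bu [i Ku]] [Bv [j Kv]]].
    split; first exact: gp1.
    by exists 0%N; rewrite expg0 invg1 mulg1; exact: gp1.
  split; first exact: sB.2.
  (* The exponent $(p-1)j$ stands for $-j$, since $t^p$ lies in [K]. *)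
  exists (i + p.-1 * j)%N.
  have -> : t ^- (i + p.-1 * j) * (u / v) =
      t ^- (p * j) * ((t ^- i * u) / (t ^- j * v)) ^ (t ^- j).
    rewrite -[in (p * j)%N](prednK (prime_gt0 pr_p)) mulSn !expgnDr.
    by rewrite conjgE !gnorm.
  apply: gpM => //; last by apply: nK; [exact: sK.2|apply: gpV => //; exact: gpX].
  by apply: gpV => //; rewrite expgnA; apply: gpX => //; exact: LK.
have AK x : A x -> K x.
  move=> Ax; have : B x /\ exists i, K (t ^- i * x).
    apply: (gen_min sC _ (genB x (AB Ax))) => z [->|[[j ->]|Phiz]].
    - by split=> //; exists 1%N; rewrite expg1 mulVg; exact: gp1.
    - split; first by apply: gpM => //; [exact: gpX|exact: AB].
      by exists (e j); rewrite mulKg; exact: LK.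
    have Kz := PhiK _ Phiz; split; first exact: KB.
    by exists 0%N; rewrite expg0 invg1 mul1g.
  move=> [_ [i Ki]]; rewrite -[x](mulVKg (t ^+ i)); apply: gpM => //.
  (* As [x] and $t^{-i}x$ are in [A], so is $t^i$; hence $p$ divides $i$, and $t^i$ is a power of
     $t^p$, which lies in [K]. *)
  have /dvdnP[m ->] : (p %| i)%N.
    apply: (prime_expg_mem sA pr_p At Atp).
    have -> : t ^+ i = x / (t ^- i * x) by rewrite invgM invgK mulVKg.
    by apply: sA.2 => //; exact: KA.
  by rewrite mulnC expgnA; apply: gpX => //; exact: LK.
(* Surjectivity of $t-1$ on $A/L$, iterated; for [n = p] the right side vanishes by
   [iter_commg_mem]. *)
have descent n x : A x -> exists2 a, A a & pi x = pi (iter n (commg^~ t) a).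
  elim: n x => [|n IHn] x Ax; first by exists x.
  have [_ [b Ab ->]] := (KE x).1 (AK _ Ax); have [a Aa ba] := IHn _ Ab.
  exists a => //=; set c := iter _ _ _ in ba *.
  have Ac : A c by rewrite /c; elim: (n) => //= k; exact: AD.
  rewrite !piD // ba; congr (_ - _)%R; apply/piE; do ?exact: At1.
  by rewrite -conjVg -conjMg; apply: Lt; apply/piE.
move=> x Ax; have [a Aa xa] := descent p x Ax.
apply/piK => //; rewrite xa; apply/piK; last exact: iter_commg_mem.
by elim: (p) => //= k; exact: AD.
Qed.

End Cyclic.

(** One generator outside [A] plays the role of [t]; the other $d-1$ give $p$ conjugates each, and
    $t^p$ is one more. The claim [0 < d] makes the truncated [d.-1] an honest difference. *)
Lemma pstep_dpgen p A B d : prime p -> pstep p A B -> dpgen p B d ->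
  (0 < d)%N /\ dpgen p A (p * d.-1).+1.
Proof.
move=> pr_p [sB nAB [t0 [Bt0 At0]] stepA] [f [Bf genf]].
have [sA [AB nA]] := nAB.
have [At0p BtA0] := stepA _ Bt0 At0.
have KAA a b : A a -> A b -> A [~ a, b] by exact: gpR.
have PhiA x : gp_Phi_p p B x -> A x.
  apply: (cyclic_ext_Phi sB nAB Bt0 BtA0) => // a Aa; last exact: gpX.
  by rewrite commgEl; apply: gpM => //; [exact: gpV|exact: nA].
(* If all generators were in [A], then so would be [B], because $[B,B]B^p\subseteq A$. *)
have [i0 Ai0] : exists i, ~ A (f i).
  apply/existsNP => Af; apply: At0; apply: (gen_min sA _ (genf _ Bt0)).
  by move=> z [[i ->]|] //; exact: PhiA.
case: d f Bf genf i0 Ai0 => [|d] f Bf genf i0; first by case: i0.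
set t := f i0 => At; split=> //=.
have [Atp BtA] := stepA t (Bf i0) At.
have /choice [e eP] : forall j : 'I_d, exists i, A (t ^- i * f (lift i0 j)).
  by move=> j; exact: BtA.
pose y j := t ^- e j * f (lift i0 j).
have -> : (p * d).+1 = #|{: option ('I_d * 'I_p)}|.
  by rewrite card_option card_prod !card_ord mulnC.
apply: dpgen_finType; last first.
  apply: (cyclic_ext_gen sB nAB (Bf i0) BtA pr_p At Atp eP (e := e)).
  move=> x /genf; apply: gen_min; first exact: gen_subgroup.
  move=> z [[i ->]|Phiz]; apply: gen_in; last by right; right.
  case: (unliftP i0 i) => [j ->|->]; last by left.
  by right; left; exists j; rewrite mulVKg.
by case=> [[j r]|] //=; apply: nA; [exact: eP|apply: gpX].
Qed.

End Step.

(** * Indices through transversals, chains of steps, and normal subgroups inside them *)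

Section Index.
Local Open Scope group_scope.
Variable G : groupType.
Implicit Types (A B H K L M N S : G -> Prop) (x y t : G).

Lemma has_index_finType N K (I : finType) (f : I -> G) : (forall i, K (f i)) ->
  (forall x, K x -> exists! i, N ((f i)^-1 * x)) -> gp_has_index N K #|I|.
Proof.
move=> Kf fP; exists (f \o enum_val); split=> [i|x /fP[i [Ni uniq_i]]]; first exact: Kf.
exists (enum_rank i); split=> [|j Nj]; first by rewrite /= enum_rankK.
by rewrite (uniq_i _ Nj) enum_valK.
Qed.

Lemma has_index_leq N K n m : gp_subgroup N ->
  gp_has_index N K n -> gp_has_index N K m -> (n <= m)%N.
Proof.
move=> sN [f [Kf fP]] [g [Kg gP]].
have /choice[j jP] i : exists j, N ((g j)^-1 * f i).
  by have [j []] := gP _ (Kf i); exists j.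
rewrite -(card_ord n) -(card_ord m); apply: (leq_card j) => i i' jii'.
have [k [_ uniq_k]] := fP _ (Kf i').
rewrite -(uniq_k i) ?(uniq_k i') ?mulVg; first by []; first exact: gp1.
have -> : (f i)^-1 * f i' = ((g (j i))^-1 * f i)^-1 * ((g (j i'))^-1 * f i').
  by rewrite jii' invgM invgK !gnorm.
by apply: gpM => //; exact: gpV.
Qed.

Lemma has_index_uniq N K n m : gp_subgroup N ->
  gp_has_index N K n -> gp_has_index N K m -> n = m.
Proof.
by move=> sN Nn Nm; apply/eqP; rewrite eqn_leq (has_index_leq sN Nn Nm)
  (has_index_leq sN Nm Nn).
Qed.

Lemma has_index_mul N H K n m : gp_subgroup H -> gp_subgroup K ->
  (forall x, N x -> H x) -> (forall x, H x -> K x) ->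
  gp_has_index N H n -> gp_has_index H K m -> gp_has_index N K (m * n).
Proof.
move=> sH sK NH HK [f [Hf fP]] [g [Kg gP]].
rewrite -(card_ord n) -(card_ord m) -card_prod.
apply: (has_index_finType (f := fun ji => g ji.1 * f ji.2)) => [[j i]|x Kx] /=.
  by apply: gpM => //; exact: HK.
have [j [Hj uniq_j]] := gP _ Kx; have [i [Ni uniq_i]] := fP _ Hj.
exists (j, i); split=> /= [|[j' i'] /=]; rewrite invgM -mulgA // => Ni'.
have jj' : j = j' by apply: uniq_j; move/NH: Ni' => /gpMl; apply=> //; exact: gpV.
by rewrite {}jj' in uniq_i *; rewrite (uniq_i _ Ni').
Qed.

Lemma gp_indexE N K n : gp_subgroup N -> gp_has_index N K n -> gp_index N K = n.
Proof.
move=> sN Nn; rewrite /gp_index /gp_minnat; case: pselect => [h|]; last by case; exists n.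
by case: ex_minnP => m /asboolP Nm _; exact: has_index_uniq Nm Nn.
Qed.

(** For any [t] outside [A], a transversal is $1,t,\dots,t^{p-1}$. *)
Lemma pstep_index p A B : prime p -> pstep p A B -> gp_has_index A B p.
Proof.
move=> pr_p [sB [sA _] [t [Bt At]] /(_ t Bt At)[Atp BtA]].
have AX m : (p %| m)%N -> A (t ^+ m).
  by case/dvdnP=> k ->; rewrite mulnC expgnA; exact: gpX.
rewrite -[X in gp_has_index _ _ X]card_ord.
apply: (has_index_finType (f := fun i : 'I_p => t ^+ i)) => [i|x /BtA[n An]].
  exact: gpX.
have n_lt : (n %% p < p)%N by rewrite ltn_mod prime_gt0.
have Amod : A (t ^- (n %% p) * x).
  have -> : t ^- (n %% p) * x = t ^+ (n %/ p * p) * (t ^- n * x).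
    by rewrite [in t ^- n](divn_eq n p) addnC expgnDr invgM -mulgA mulVKg.
  by apply: gpM => //; apply: AX; exact: dvdn_mull.
exists (Ordinal n_lt); split=> // j Aj; apply/val_inj => /=.
have leq_eq i k : (i <= k)%N -> (k < p)%N -> A (t ^- i * x) -> A (t ^- k * x) -> i = k.
  move=> ik kp Ai Ak; apply/eqP; rewrite eqn_leq ik -subn_eq0 /=.
  have : (p %| k - i)%N.
    apply: (prime_expg_mem sA pr_p At Atp).
    have -> : t ^+ (k - i) = (t ^- i * x) / (t ^- k * x).
      rewrite -{2}(subnK ik) addnC expgnDr !invgM !invgK.
      by rewrite !gnorm.
    by apply: sA.2.
  apply: contraLR; rewrite -lt0n => ki; rewrite gtnNdvd //.
  exact: leq_ltn_trans (leq_subr _ _) kp.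
have [nj|jn] := leqP (n %% p) j; first exact: (leq_eq _ _ nj).
by apply/esym; apply: (leq_eq _ _ (ltnW jn)).
Qed.

(** Chains are built downwards from the fixed top [K]; for prime [p] their length is the exponent of
    $p$ in the index. *)
Inductive pchain p K : nat -> (G -> Prop) -> Prop :=
| pchain0 : pchain p K 0 K
| pchainS k A B : pstep p A B -> pchain p K k B -> pchain p K k.+1 A.

Lemma pchain_sub p K k N : pchain p K k N -> forall x, N x -> K x.
Proof. by elim=> // l A B [_ [_ [AB _]] _ _] _ IH x /AB/IH. Qed.

Lemma pchain_trans p A B C k l : pchain p B k A -> pchain p C l B ->
  pchain p C (k + l) A.
Proof.
by move=> AB BC; elim: AB => // m A' B' A'B' _; rewrite addSn; exact: pchainS.
Qed.

Lemma pchain_index p K k N : prime p -> gp_subgroup K -> pchain p K k N ->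
  gp_has_index N K (p ^ k).
Proof.
move=> pr_p sK; elim=> [|l A B stepA chainB IH].
  rewrite expn0 -card_unit.
  apply: (has_index_finType (f := fun=> 1)) => [_|x Kx]; first exact: gp1.
  by exists tt; split=> [|[]//]; rewrite invg1 mul1g.
have [sB [sA [AB _]] _ _] := stepA.
rewrite expnSr; apply: (has_index_mul sB) => //; last exact: pstep_index.
exact: pchain_sub chainB.
Qed.

Lemma pchain_dpgen p K k N d : prime p -> pchain p K k N -> dpgen p K d ->
  exists e, dpgen p N e.
Proof.
move=> pr_p chainN Kd; elim: chainN => [|l A B stepA _ [e Be]]; first by exists d.
by have [_ Ae] := pstep_dpgen pr_p stepA Be; eexists; exact: Ae.
Qed.

Definition capP A B x := A x /\ B x.

Lemma cap_subgroup A B : gp_subgroup A -> gp_subgroup B -> gp_subgroup (capP A B).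
Proof.
move=> sA sB; split=> [|x y [Ax Bx] [Ay By]]; first by split; exact: gp1.
by split; [exact: sA.2|exact: sB.2].
Qed.

Lemma cap_normal N H K : gp_normal N K -> gp_subgroup H ->
  gp_normal (capP N H) (capP K H).
Proof.
move=> [sN [NK nN]] sH; split; first exact: cap_subgroup.
split=> [x [/NK Kx Hx]|x k [Nx Hx] [Kk Hk]]; first by [].
by split; [exact: nN|exact: gpJ].
Qed.

Lemma capPE A B : (forall x, B x -> A x) -> capP A B = B.
Proof.
move=> BA; apply/funext => x; apply/propext; split=> [[]//|Bx].
by split; first exact: BA.
Qed.

Lemma capPC A B : capP A B = capP B A.
Proof. by apply/funext => x; apply/propext; split=> -[]. Qed.

(** The first case occurs when $B\cap H$ lies in [A]; otherwise the elements of $B\cap H$ outside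
    [A] inherit the conditions on powers. *)
Lemma pstep_cap p A B H : pstep p A B -> gp_subgroup H ->
  capP A H = capP B H \/ pstep p (capP A H) (capP B H).
Proof.
move=> [sB nAB _ stepA] sH; have [_ [AB _]] := nAB.
have [[t [[Bt Ht] At]]|nt] := pselect (exists t, capP B H t /\ ~ A t); [right|left].
  split; [exact: cap_subgroup|exact: cap_normal|by exists t; split=> // -[]|].
  move=> u [Bu Hu] AHu; have Au : ~ A u by move=> Au; exact: AHu.
  have [Aup BuA] := stepA u Bu Au; split=> [|x [/BuA[i Ai] Hx]].
    by split=> //; exact: gpX.
  by exists i; split=> //; apply: gpM => //; apply: gpV => //; exact: gpX.
apply/funext => x; apply/propext; split=> -[]; first by move/AB.
by move=> Bx Hx; split=> //; apply: contrapT => Ax; apply: nt; exists x.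
Qed.

Lemma pchain_cap p K k N H : gp_subgroup H -> pchain p K k N ->
  exists l, pchain p (capP K H) l (capP N H).
Proof.
move=> sH; elim=> [|l A B /pstep_cap/(_ sH)[-> //|stepA] _ [m chainB]].
  by exists 0%N; exact: pchain0.
by exists m.+1; exact: pchainS stepA chainB.
Qed.

Lemma pstep_conj p A B g : pstep p A B -> gp_normal B setT ->
  pstep p (fun x => A (x ^ g)) B.
Proof.
move=> [sB [sA [AB nA]] [t [Bt At]] stepA] [_ [_ nB]].
have BJ x h : B x -> B (x ^ h) by move=> Bx; exact: nB.
split=> //.
- split; first split=> [|x y Ax Ay]; first by rewrite conj1g; exact: gp1.
    by rewrite conjMg conjVg; exact: sA.2.
  split=> [x /AB /(BJ _ g^-1)|x k Ax Bk]; first by rewrite conjgK.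
  by rewrite -conjgM conjgC conjgM; apply: nA => //; exact: BJ.
- by exists (t ^ g^-1); rewrite conjgKV; split=> //; exact: BJ.
move=> u Bu Au; have [Aup BuA] := stepA _ (BJ _ g Bu) Au.
rewrite conjXg; split=> // x Bx; have [i Ai] := BuA _ (BJ _ g Bx).
by exists i; rewrite conjMg conjVg conjXg.
Qed.

(** Suppose a normal [B'] below [B] is found. Then $A'=A\cap B'$ is [B'] or a step below it, and the
    intersection of the conjugates of [A'] is normal. Finitely many conjugates suffice since [B']
    has finite index, and each adds at most one step to the chain. *)
Lemma pchain_core p k M : prime p -> pchain p setT k M ->
  exists l N, [/\ gp_normal N setT, forall x, N x -> M x & pchain p setT l N].
Proof.
have sT : gp_subgroup (setT : G -> Prop) by [].
move=> pr_p; elim=> [|m A B stepA _ [l [B' [nB' B'B chainB']]]].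
  by exists 0%N, setT; split=> //; exact: pchain0.
have [sB' _] := nB'.
case: (pstep_cap stepA sB') => [AB'|].
  by exists l, B'; split=> // x B'x; have [] : capP A B' x by rewrite AB' capPE.
rewrite (capPE B'B); set A' := capP A B' => stepA'.
have [_ [sA' [A'B' nA']] _ _] := stepA'.
pose C (s : seq G) x := B' x /\ forall g, g \in s -> A' (x ^ g).
have sC s : gp_subgroup (C s).
  split=> [|x y [Bx Cx] [By Cy]].
    by split=> [|g _]; rewrite ?conj1g; exact: gp1.
  split=> [|g gs]; first exact: sB'.2.
  by rewrite conjMg conjVg; apply: sA'.2; [exact: Cx|exact: Cy].
have chainC s : exists n, pchain p B' n (C s).
  elim: s => [|g s [n chainC]].
    exists 0%N; suff -> : C [::] = B' by exact: pchain0.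
    by apply/funext => x; apply/propext; split=> [[]|].
  have CE : C (g :: s) = capP (fun x => A' (x ^ g)) (C s).
    apply/funext => x; apply/propext; split=> [[B'x Cx]|[Ag [B'x Cx]]].
      split; first by apply: Cx; rewrite mem_head.
      by split=> // h hs; apply: Cx; rewrite inE hs orbT.
    by split=> // h; rewrite inE => /predU1P[->//|]; exact: Cx.
  have BCE : capP B' (C s) = C s by apply: capPE => x [].
  have := pstep_cap (pstep_conj g stepA' nB') (sC s).
  rewrite -CE BCE => -[->|stepC]; first by exists n.
  by exists n.+1; exact: pchainS stepC chainC.
have [f [_ fP]] := pchain_index pr_p sT chainB'.
(* The list runs over representatives of the cosets of [B']; any other conjugation differs from one
   of these by an element of [B'], which normalizes [A']. *)
have [n chainN] := chainC [seq f i | i : 'I_(p ^ l)].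
exists (n + l)%N, (C [seq f i | i : 'I_(p ^ l)]); split.
- split; first exact: sC.
  split=> // x h Cx _; have [B'x Ax] := Cx.
  have AxJ g : A' (x ^ g).
    have [i [B'i _]] := fP g I; rewrite -[g](mulVKg (f i)) conjgM.
    by apply: nA' => //; apply: Ax; apply: codom_f.
  have [_ [_ nB]] := nB'.
  by split=> [|g _]; [exact: nB|rewrite -conjgM].
- move=> x [B'x Cx]; have [i [B'i _]] := fP 1 I.
  have : A' ((x ^ f i) ^ ((f i)^-1 * 1)).
    by apply: nA' => //; apply: Cx; apply: codom_f.
  by rewrite -conjgM mulVKg conjg1 => -[].
exact: pchain_trans chainN chainB'.
Qed.

End Index.

(** * Chains pulled back from a finite quotient *)

Section FiniteQuotient.
Local Open Scope group_scope.
Variables (G : groupType) (gT : finGroupType) (phi : G -> gT) (P : {group gT}).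
Hypothesis phiM : forall x y, phi (x * y) = phi x * phi y.
Hypothesis phiP : forall s, s \in P <-> exists x, phi x = s.

Let phi1 : phi 1 = 1.
Proof. by apply: (mulgI (phi 1)); rewrite -phiM !mulg1. Qed.

Let phiV x : phi x^-1 = (phi x)^-1.
Proof. by apply: (mulgI (phi x)); rewrite -phiM !mulgV phi1. Qed.

Let phiX x n : phi (x ^+ n) = phi x ^+ n.
Proof. by elim: n => [|n IHn]; rewrite ?phi1 // !expgS phiM IHn. Qed.

Let phiJ x y : phi (x ^ y) = phi x ^ phi y.
Proof. by rewrite /conjg !phiM phiV. Qed.

Lemma preim_subgroup (Q : {group gT}) : gp_subgroup (fun x => phi x \in Q).
Proof.
by split=> [|x y Qx Qy]; rewrite ?phi1 ?group1 // phiM phiV groupM ?groupV.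
Qed.

(** $Q_1/Q$ has prime order, so each nontrivial element generates it and the powers of [t] reach
    every coset. *)
Lemma preim_pstep p (Q Q1 : {group gT}) : prime p -> Q <| Q1 -> Q1 \subset P ->
  #|Q1 : Q| = p -> pstep p (fun x => phi x \in Q) (fun x => phi x \in Q1).
Proof.
move=> pr_p nQQ1 sQ1P iQ; have [sQQ1 sQ1N] := andP nQQ1.
have cQ : #|quotient Q1 Q| = p by rewrite card_quotient.
split; first exact: preim_subgroup.
- split; first exact: preim_subgroup.
  split=> [x Qx|x k Qx Q1k]; first exact: (fintype.subsetP sQQ1 _ Qx).
  by rewrite phiJ memJ_norm // (fintype.subsetP sQ1N).
- have : ~~ (Q1 \subset Q) by rewrite -indexg_gt1 iQ prime_gt1.
  case/subsetPn=> s Q1s Qs; have /phiP[x xs] := fintype.subsetP sQ1P _ Q1s.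
  by exists x; rewrite xs; split=> //; exact/negP.
move=> t Q1t /negP Qt; have Nt := fintype.subsetP sQ1N _ Q1t.
have mt : coset Q (phi t) \in quotient Q1 Q by exact: mem_quotient.
split=> [|x Q1x].
  rewrite phiX; apply: coset_idr; first exact: groupX.
  by rewrite morphX // -cQ expg_cardG.
have Nx := fintype.subsetP sQ1N _ Q1x.
have genQ : quotient Q1 Q = <[coset Q (phi t)]>.
  apply: nt_gen_prime; first by rewrite cQ.
  by rewrite !inE mt andbT; apply: contra Qt => /eqP; exact: coset_idr.
have : coset Q (phi x) \in quotient Q1 Q by exact: mem_quotient.
rewrite genQ => /cycleP[i xi]; exists i.
rewrite phiM phiV phiX; apply: coset_idr; first by rewrite groupM ?groupV ?groupX.
by rewrite morphM ?morphV ?morphX ?groupV ?groupX //= xi mulVg.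
Qed.

(** If [Q] is not [P], it is normal in a larger subnormal [K], and the nontrivial $p$-group $K/Q$
    has a normal subgroup of order $p$. Its preimage [Q1] is subnormal in [P] of smaller index,
    which drives the induction. *)
Lemma preim_pchain p (Q : {group gT}) : prime p -> Q <|<| P -> p.-nat #|P : Q| ->
  exists l, pchain p setT l (fun x => phi x \in Q).
Proof.
move=> pr_p; move: {2}#|P : Q| (leqnn #|P : Q|) => n.
elim: n Q => [|n IHn] Q; first by rewrite leqNgt indexg_gt0.
move=> lePQ snQP pPQ.
have [->|[K [nQK snKP prQK]]] := subnormalEl snQP.
  exists 0%N; suff -> : (fun x => is_true (phi x \in P)) = setT by exact: pchain0.
  by apply/funext => x; apply/propext; split=> // _; apply/phiP; exists x.
have sKP := subnormal_sub snKP; have [sQK sKN] := andP nQK.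
have pKQ : p.-group (quotient K Q).
  by rewrite /pgroup card_quotient // (pnat_dvd _ pPQ) // indexSg.
have ntKQ : (0 < logn p #|quotient K Q|)%N.
  have [_ pdiv _] : [/\ prime p, p %| #|quotient K Q| & exists m, #|quotient K Q| = p ^ m.+1]%N.
    apply: (pgroup_pdiv pKQ); rewrite -subG1 quotient_sub1 //.
    by have /andP[] := prQK.
  by rewrite logn_gt0 mem_primes pr_p pdiv cardG_gt0.
have [R [_ nRKQ cR]] := normal_pgroup pKQ (normal_refl _) ntKQ.
have [Q1 RE sQQ1 nQ1K] := inv_quotientN nQK nRKQ.
have [sQ1K _] := andP nQ1K.
have nQQ1 : Q <| Q1 by exact: normalS nQK.
have iQ : #|Q1 : Q| = p by rewrite -card_quotient ?normal_norm // -RE cR expn1.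
have sQ1P := fintype.subset_trans sQ1K sKP.
have iP : (#|P : Q1| * p = #|P : Q|)%N by rewrite -(Lagrange_index sQ1P sQQ1) iQ.
have [l chainQ1] : exists l, pchain p setT l (fun x => phi x \in Q1).
  apply: IHn.
  - rewrite -ltnS (leq_trans _ lePQ) // -iP.
    by rewrite ltn_Pmulr ?prime_gt1.
  - exact: subnormal_trans (normal_subnormal nQ1K) snKP.
  by apply: pnat_dvd pPQ; rewrite -iP dvdn_mulr.
by exists l.+1; apply: pchainS chainQ1; exact: preim_pstep.
Qed.

End FiniteQuotient.

(** * From subnormality to chains of steps of index $p$ *)

Section Subnormal.
Local Open Scope group_scope.
Variable G : groupType.
Implicit Types (H : G -> Prop).

(** The action of [G] on the $p^k$ cosets of [H] reduces the claim to finite groups: [H] is the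
    stabilizer of a point, hence the preimage of its image, and subnormal series map to subnormal
    series. *)
Lemma subnormal_pchain p k H : prime p -> gp_subgroup H ->
  gp_subnormal H setT -> gp_has_index H setT (p ^ k) ->
  exists l, pchain p setT l H.
Proof.
move=> pr_p sH [m [c [c0 [cm cN]]]] [f [_ fP]].
have /choice[J JP] y : exists j, H ((f j)^-1 * y).
  by have [j []] := fP y I; exists j.
have J_uniq y j : H ((f j)^-1 * y) -> J y = j.
  move=> Hj; have [i [_ uniq_i]] := fP y I.
  by rewrite -(uniq_i _ Hj) -(uniq_i _ (JP y)).
have JE y z : H (y^-1 * z) -> J z = J y.
  move=> Hyz; apply: J_uniq; rewrite -[z](mulVKg y) mulgA.
  by apply: gpM.
have Jf j : J (f j) = j by apply: J_uniq; rewrite mulVg; exact: gp1.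
(* The inverse turns left multiplication on cosets into a right action, matching the order of
   composition of permutations. *)
pose a x i := J (x^-1 * f i).
have aM x y i : a (x * y) i = a y (a x i).
  rewrite /a invgM -mulgA; apply: JE; rewrite invgM invgK -mulgA mulVKg.
  exact: JP.
have aK x : cancel (a x) (a x^-1).
  by move=> i; rewrite -aM mulgV /a invg1 mul1g Jf.
pose phi x : {perm 'I_(p ^ k)} := perm (can_inj (aK x)).
have phiE x i : phi x i = a x i by rewrite permE.
have phiM x y : phi (x * y) = (phi x * phi y)%g.
  by apply/permP => i; rewrite permM !phiE aM.
pose im (C : G -> Prop) := [set s | `[< exists2 x, C x & phi x = s >]].
have imP C s : reflect (exists2 x, C x & phi x = s) (s \in im C).
  by rewrite inE; exact: asboolP.
have phi1 : phi 1 = 1 by apply: (mulgI (phi 1)); rewrite -phiM !mulg1.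
have phiV x : phi x^-1 = (phi x)^-1.
  by apply: (mulgI (phi x)); rewrite -phiM !mulgV phi1.
have im_group C : gp_subgroup C -> group_set (im C).
  move=> sC; apply/group_setP; split=> [|s u /imP[x Cx <-] /imP[y Cy <-]].
    by apply/imP; exists 1; [exact: gp1|].
  by apply/imP; exists (x * y); [exact: gpM|].
pose P := group (im_group setT (conj I (fun _ _ _ _ => I))).
pose Q := group (im_group H sH).
pose i0 := J 1.
have HE x : H x <-> phi x i0 = i0.
  have Hf : H (f i0).
    by rewrite -[f i0]invgK; apply: gpV => //; rewrite -[_^-1]mulg1; exact: JP.
  rewrite phiE /a; split=> [Hx|xi0].
    apply: J_uniq; apply: gpM => //; first exact: gpV.
    by apply: gpM => //; exact: gpV.
  have := JP (x^-1 * f i0); rewrite xi0.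
  move=> /(gpMl sH _ (gpV sH Hf)) /(gpMr sH _ Hf) /(gpV sH).
  by rewrite invgK.
have QE x : phi x \in Q <-> H x.
  split=> [/imP[y Hy yx]|Hx]; last by apply/imP; exists x.
  by apply/HE; rewrite -yx; apply/HE.
have phiP s : s \in P <-> exists x, phi x = s.
  by split=> [/imP[x _ <-]|[x <-]]; [exists x|apply/imP; exists x].
have snQP : Q <|<| P.
  suff /(_ m (leqnn m))[D DE snQD] j : (j <= m)%N ->
      exists2 D : {group _}, D :=: im (c j) & Q <|<| D.
    by have <- : D = P by apply/val_inj; rewrite /= DE cm.
  elim: j => [_|j IHj jm].
    by exists Q; [rewrite c0|exact: subnormal_refl].
  have [D DE snQD] := IHj (ltnW jm).
  have [sj [jj1 nj]] := cN _ jm.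
  have sj1 : gp_subgroup (c j.+1).
    (* [cN] shows [c j.+1] to be a subgroup only as the lower member of a pair; the last member is
       the whole group and is treated apart. *)
    have [->|neq] := eqVneq j.+1 m; first by rewrite cm.
    by have := cN j.+1; rewrite ltn_neqAle neq jm => /(_ isT)[].
  exists (group (im_group _ sj1)) => //.
  apply: subnormal_trans snQD (normal_subnormal _).
  apply/normalP; rewrite /= DE; split.
    by apply/fintype.subsetP => s /imP[x /jj1 cx <-]; apply/imP; exists x.
  move=> _ /imP[y cy <-]; apply/eqP; rewrite eqEcard cardJg leqnn andbT.
  apply/fintype.subsetP => _ /imsetP[_ /imP[x cx <-] ->]; apply/imP; exists (x ^ y).
    exact: nj.
  by rewrite /conjg !phiM phiV.
(* [Q] is the stabilizer of [i0] in the transitive group [P]. *)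
have iPQ : #|P : Q| = (p ^ k)%N.
  have -> : Q :=: 'C_P[i0 | 'P].
    apply/setP => s; apply/idP/idP => [/imP[x Hx <-]|].
      apply/setIP; split; first by apply/imP; exists x.
      by apply/astab1P; exact/HE.
    case/setIP=> /imP[x _ <-] /astab1P /= xi0; apply/imP; exists x => //.
    exact/HE.
  rewrite -card_orbit (_ : orbit _ _ _ = finset.setT) ?cardsT ?card_ord //.
  apply/setP => j; rewrite inE; apply/orbitP; exists (phi (f i0 / f j)).
    by apply/imP; eexists.
  by rewrite /= apermE phiE /a invgM invgK mulgVK Jf.
have pPQ : p.-nat #|P : Q| by rewrite iPQ pnatX pnat_id.
have [l] := preim_pchain phiM phiP pr_p snQP pPQ.
have -> : (fun x => is_true (phi x \in Q)) = H.
  by apply/funext => x; apply/propext.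
by exists l.
Qed.

End Subnormal.

(** * Bounds for the infimum defining $RG_p$ *)

Section RankGradient.
Variables (R : realType) (G : groupType) (p : nat).
Hypothesis pr_p : prime p.
Implicit Types (H K L M N : G -> Prop).

Lemma gp_dp_min N d : dpgen p N d ->
  dpgen p N (gp_dp p N) /\ (gp_dp p N <= d)%N.
Proof.
move=> Nd; rewrite /gp_dp /gp_minnat; case: pselect => [h|]; last by case; exists d.
by case: ex_minnP => m /asboolP Nm min_m; split=> //; apply: min_m; apply/asboolP.
Qed.

(** Schreier's inequality multiplied along the chain. The hypothesis [dpgen p K d] ensures that the
    values of [gp_dp] are true minima. *)
Lemma pchain_rank K k N d : dpgen p K d -> pchain p K k N ->
  (gp_dp p N)%:R - 1 <= (p ^ k)%:R * ((gp_dp p K)%:R - 1) :> R.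
Proof.
move=> Kd; elim=> [|l A B stepA chainB IH]; first by rewrite expn0 mul1r.
have [e Be] := pchain_dpgen pr_p chainB Kd.
have [dB_gt0 /gp_dp_min[_ dA]] := pstep_dpgen pr_p stepA (gp_dp_min Be).1.
rewrite expnS natrM -mulrA.
apply: le_trans (ler_wpM2l (ler0n R p) IH).
rewrite -(prednK dB_gt0) -addn1 natrD addrK -natrM lerBlDr -(natrD _ _ 1%N) addn1.
by rewrite ler_nat.
Qed.

Definition rank_ratios K : set R :=
  [set ((gp_dp p N)%:R - 1) / (gp_index N K)%:R | N in
        [set N | gp_normal N K /\ gp_ppower_index p N K]]%classic.

(** The numerator is at least $-1$ and the denominator at least 1. Together with non-emptiness this
    makes [inf] a true infimum. *)
Lemma rank_ratios_lbound K : has_lbound (rank_ratios K).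
Proof.
exists (-1) => _ [N [[sN _] [k Nk]] <-]; rewrite (gp_indexE sN Nk).
have pk : 1 <= (p ^ k)%:R :> R by rewrite ler1n expn_gt0 prime_gt0.
rewrite ler_pdivlMr ?(lt_le_trans ltr01) // mulN1r lerBrDr.
by rewrite (le_trans _ (ler0n _ _)) // addrC subr_le0.
Qed.

Lemma rank_ratios_neq0 K : gp_subgroup K -> (rank_ratios K !=set0)%classic.
Proof.
move=> sK; eexists; exists K => //; split.
  by split=> //; split=> // x k Kx Kk; exact: gpJ.
by exists 0%N; apply: (pchain_index pr_p sK (pchain0 p K)).
Qed.

Lemma gp_RGp_le K k N : gp_normal N K -> gp_has_index N K (p ^ k) ->
  gp_RGp R p K <= ((gp_dp p N)%:R - 1) / (p ^ k)%:R.
Proof.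
move=> nNK Nk; have [sN _] := nNK.
rewrite -(gp_indexE sN Nk); apply: ge_inf; first exact: rank_ratios_lbound.
by exists N => //; split=> //; exists k.
Qed.

Lemma le_gp_RGp K c : gp_subgroup K ->
  (forall k N, gp_normal N K -> gp_has_index N K (p ^ k) ->
    c <= ((gp_dp p N)%:R - 1) / (p ^ k)%:R) -> c <= gp_RGp R p K.
Proof.
move=> sK cP; apply: lb_le_inf; first exact: rank_ratios_neq0.
by move=> _ [N [nNK [k Nk]] <-]; have [sN _] := nNK; rewrite (gp_indexE sN Nk); exact: cP.
Qed.

Lemma gp_subnormal_normal N H : gp_normal N H -> gp_subnormal H setT ->
  gp_subnormal N setT.
Proof.
move=> nNH [n [c [c0 [cn cN]]]].
exists n.+1, (fun i => if i is j.+1 then c j else N); split=> //; split=> //.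
by case=> [_|i /cN//]; rewrite c0.
Qed.

Lemma fin_gen_dpgen : gp_fin_gen G -> exists d, dpgen p (setT : G -> Prop) d.
Proof.
move=> [n [f genf]]; exists n, f; split=> // x _; move: (genf x).
by apply: gen_min => [|y [i ->]]; [exact: gen_subgroup|apply: gen_in; left; exists i].
Qed.

End RankGradient.

Theorem theorem2p9 (R : realType) (p : nat) (G : groupType) (H : G -> Prop) :
  prime p -> gp_fin_gen G -> gp_subgroup H ->
  gp_subnormal H [set: G]%classic -> gp_ppower_index p H [set: G]%classic ->
  gp_RGp R p [set: G]%classic = gp_RGp R p H / (gp_index H [set: G]%classic)%:R.
Proof.
move=> pr_p fgG sH snH [k Hk].
have sT : gp_subgroup [set: G]%classic by [].
have [dG dGP] := fin_gen_dpgen p fgG.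
rewrite (gp_indexE sH Hk).
have p_gt0 m : 0 < (p ^ m)%:R :> R by rewrite ltr0n expn_gt0 prime_gt0.
have [h chainH] := subnormal_pchain pr_p sH snH Hk.
have pchain_exp (N : G -> Prop) m l : gp_subgroup N -> gp_has_index N setT (p ^ m) ->
    pchain p setT l N -> l = m.
  move=> sN Nm chainN; have := has_index_uniq sN (pchain_index pr_p sT chainN) Nm.
  by move/eqP; rewrite eqn_exp2l ?prime_gt1 // => /eqP.
have hE := pchain_exp _ _ _ sH Hk chainH; rewrite {}hE in chainH.
apply/eqP; rewrite eq_le; apply/andP; split.
  (* Below each [N] normal in [H] lies an [M] normal in [G]; the chain from [G] to [M], cut with
     [N], becomes a chain from [N] to [M]. *)
  rewrite ler_pdivlMr //; apply: le_gp_RGp => // j N nNH Nj.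
  have [sN [NH _]] := nNH.
  have NG := has_index_mul sH sT NH (fun _ _ => I) Nj Hk.
  rewrite -expnD in NG.
  have [l chainN] := subnormal_pchain pr_p sN (gp_subnormal_normal nNH snH) NG.
  have [m [M [nMG MN chainM]]] := pchain_core pr_p chainN.
  have [sM _] := nMG.
  have [i] := pchain_cap sN chainM.
  rewrite (capPE (A := setT)) // (capPC M) (capPE MN) => chainMN.
  have lE := pchain_exp _ _ _ sN NG chainN.
  have Mm := pchain_index pr_p sT chainM.
  have mE := pchain_exp _ _ _ sM Mm (pchain_trans chainMN chainN).
  have [d dN] := pchain_dpgen pr_p chainN dGP.
  rewrite -ler_pdivlMr //; apply: le_trans (gp_RGp_le R pr_p nMG Mm) _.
  rewrite ler_pdivrMr //; apply: le_trans (pchain_rank R pr_p dN chainMN) _.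
  (* Here $m=i+l$ and $l=k+j$, that is, $[G:M]=[N:M][H:N][G:H]$. *)
  rewrite -mE lE !expnD !natrM [leRHS]mulrCA.
  by apply: ler_wpM2l; rewrite ?ler0n // mulrA !divfK ?gt_eqF.
(* For the reverse inequality each [N] normal in [G] is compared with $N\cap H$, normal in [H]; the
   chain for [H], cut with [N], joins [N] to $N\cap H$. *)
apply: le_gp_RGp => // j N nNG Nj.
have [sN _] := nNG.
have snT : gp_subnormal [set: G]%classic setT by exists 0%N, (fun=> setT).
have [l chainN] := subnormal_pchain pr_p sN (gp_subnormal_normal nNG snT) Nj.
have lE := pchain_exp _ _ _ sN Nj chainN; rewrite {}lE in chainN.
have [a] := pchain_cap sH chainN; have [b] := pchain_cap sN chainH.
have := cap_normal nNG sH.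
rewrite !(capPE (A := setT)) // (capPC H) => nNH chainNHN chainNHH.
have sNH : gp_subgroup (capP N H) by case: nNH.
have NHH := pchain_index pr_p sH chainNHH.
have abE := pchain_exp _ _ _ sNH
  (pchain_index pr_p sT (pchain_trans chainNHN chainN)) (pchain_trans chainNHH chainH).
have [d dN] := pchain_dpgen pr_p chainN dGP.
rewrite ler_pdivrMr //; apply: le_trans (gp_RGp_le R pr_p nNH NHH) _.
rewrite ler_pdivrMr //; apply: le_trans (pchain_rank R pr_p dN chainNHN) _.
(* The index of $N\cap H$ in [G], counted through [H] and through [N], gives $a+k=b+j$. *)
have -> : (p ^ j)%:R = (p ^ a)%:R * (p ^ k)%:R / (p ^ b)%:R :> R.
  by rewrite -natrM -expnD abE addnC expnD natrM mulfK ?gt_eqF.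
rewrite invf_div mulrA -2!mulrA (mulrC _ (p ^ a)%:R) !mulrA.
rewrite -(mulrA _ (p ^ a)%:R) divfK 1?mulrC //.
by rewrite mulf_neq0 ?gt_eqF.
Qed.
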